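(* Let $M$ be a domain of Euclidean $3$-space $\mathbb R^3$, let $(\xi_1,\xi_2,\xi_3)$ be a right-handed orthonormal basis of $\mathbb R^3$, and let $\sigma$ be a smooth unit vector field on $M$ with $\sigma(x)\neq\pm\xi_3$ for all $x\in M$, expressed in polar form $$\sigma=\cos u\,\sin v\,\xi_1+\sin u\,\sin v\,\xi_2+\cos v\,\xi_3,$$ where $u,v$ are smooth real-valued functions ($u$ in general being only locally defined, up to integer multiples of $2\pi$). Then the bending of $\sigma$ is $$|\nabla\sigma|^2=|\nabla v|^2+\sin^2 v\,|\nabla u|^2,$$ and $\sigma$ is harmonic if and only if $$\Delta u=2(\nabla u\cdot\nabla v)\cot v,$$ $$\Delta v=-|\nabla u|^2\cos v\,\sin v.$$
   Context: A smooth unit vector field $\sigma$ on a Riemannian manifold is harmonic if $\nabla^*\nabla\sigma=|\nabla\sigma|^2\sigma$, where $\nabla$ is the Levi-Civita connection and $\nabla^*\nabla=-\mathrm{Tr}\,\nabla^2$. The function $|\nabla\sigma|^2$ is called the bending of $\sigma$. Sign convention for the Laplacian on functions: $\Delta f=-\mathrm{Tr}\,\nabla df=-\mathrm{div}(\nabla f)$, where $\nabla f$ denotes the gradient. *)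

(* Defs.v *)
From HB Require Import structures.
From mathcomp Require Import all_boot all_order all_algebra.
From mathcomp Require Import all_classical all_reals all_analysis.

Set Implicit Arguments.
Unset Strict Implicit.
Unset Printing Implicit Defensive.

Import Order.TTheory GRing.Theory Num.Theory.
Import numFieldNormedType.Exports.

Local Open Scope classical_set_scope.
Local Open Scope ring_scope.

(* The norm that the library puts on ['rV[R]_3] is the sup norm. It induces the
   usual topology and the usual notion of derivative, but it is not the Euclidean
   norm: all metric notions below go through [dot]. *)
Notation E3 R := 'rV[R]_3.

Definition dot {R : realType} (a b : E3 R) : R := \sum_(i < 3) a 0 i * b 0 i.

Definition normsq {R : realType} (a : E3 R) : R := dot a a.

Definition right_handed_orthonormal {R : realType} (xi : 'I_3 -> E3 R) : Prop :=
  (forall i j, dot (xi i) (xi j) = (i == j)%:R) /\ 0 < \det (\matrix_i xi i).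

Definition domain {R : realType} (M : set (E3 R)) : Prop :=
  [/\ M !=set0, open M & connected M].

(* On an open set [A], being C^k for the differential [x |-> 'd f x] amounts, in
   finite dimension, to being C^k for each [x |-> 'D_a f x]. Functions are total;
   only their values on [A] matter. *)
Fixpoint Ck_on {R : realType} {W : normedModType R} (k : nat) (A : set (E3 R))
    (f : E3 R -> W) {struct k} : Prop :=
  if k is k'.+1 then
    (forall x, A x -> differentiable f x) /\ (forall a, Ck_on k' A ('D_a f))
  else forall x, A x -> {for x, continuous f}.

Definition smooth_on {R : realType} {W : normedModType R} (A : set (E3 R))
    (f : E3 R -> W) : Prop := forall k, Ck_on k A f.

Definition smooth_unit_field {R : realType} (M : set (E3 R))
    (sigma : E3 R -> E3 R) : Prop :=
  smooth_on M sigma /\ (forall x, M x -> normsq (sigma x) = 1).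

(* The Levi-Civita connection of the Euclidean metric: [nabla X Y] is the
   derivative of the field [Y] along the field [X]. *)
Definition nabla {R : realType} (X Y : E3 R -> E3 R) : E3 R -> E3 R :=
  fun x => 'D_(X x) Y x.

Definition nabla2 {R : realType} (X Y sigma : E3 R -> E3 R) : E3 R -> E3 R :=
  fun x => nabla X (nabla Y sigma) x - nabla (nabla X Y) sigma x.

(* The standard orthonormal frame, in which traces are computed. *)
Definition frame {R : realType} (i : 'I_3) : E3 R -> E3 R := cst (delta_mx 0 i).

Definition rough_laplacian {R : realType} (sigma : E3 R -> E3 R) : E3 R -> E3 R :=
  fun x => - \sum_(i < 3) nabla2 (frame i) (frame i) sigma x.

Definition bending {R : realType} (sigma : E3 R -> E3 R) : E3 R -> R :=
  fun x => \sum_(i < 3) normsq (nabla (frame i) sigma x).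

Definition harmonic_field {R : realType} (M : set (E3 R)) (sigma : E3 R -> E3 R) : Prop :=
  forall x, M x -> rough_laplacian sigma x = bending sigma x *: sigma x.

Definition grad {R : realType} (f : E3 R -> R) : E3 R -> E3 R :=
  fun x => \row_(i < 3) 'D_(frame i x) f x.

Definition div {R : realType} (X : E3 R -> E3 R) : E3 R -> R :=
  fun x => \sum_(i < 3) dot (nabla (frame i) X x) (frame i x).

(* Geometers' sign: the Laplacian is minus the sum of the second derivatives. *)
Definition laplacian {R : realType} (f : E3 R -> R) : E3 R -> R :=
  fun x => - div (grad f) x.

Definition cot {R : realType} (t : R) : R := cos t / sin t.

(* [v] is defined on all of [M], while [u] is given by smooth branches [u i] on
   open sets [U i] covering [M]. Where [sin (v x) != 0], the last condition forces
   two branches defined at [x] to differ there by a multiple of [2 * pi]. A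
   globally defined [u] is the case of a single branch with [U i = M]. *)
Definition polar_form {R : realType} (M : set (E3 R)) (xi : 'I_3 -> E3 R)
    (sigma : E3 R -> E3 R) (I : Type) (U : I -> set (E3 R))
    (u : I -> E3 R -> R) (v : E3 R -> R) : Prop :=
  [/\ smooth_on M v,
      M = \bigcup_i U i,
      forall i, open (U i),
      forall i, smooth_on (U i) (u i) &
      forall i x, U i x ->
        sigma x = (cos (u i x) * sin (v x)) *: xi 0
                + (sin (u i x) * sin (v x)) *: xi 1
                + cos (v x) *: xi 2].

(* Main.v *)
Require Import Defs.
From mathcomp Require Import all_boot all_order all_algebra.
From mathcomp Require Import all_classical all_reals all_analysis.
From mathcomp Require Import ring.

Set Implicit Arguments.
Unset Strict Implicit.
Unset Printing Implicit Defensive.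

Import Order.TTheory GRing.Theory Num.Theory.
Import numFieldNormedType.Exports.
Local Open Scope classical_set_scope.
Local Open Scope ring_scope.

(** Read the polar form as a map into the unit sphere in spherical coordinates,
    with longitude [u] and polar angle [v]. At each point the field [sigma]
    (the vector [radial]), the unit tangent [meridian] and the unit tangent
    [parallel] form an orthonormal frame, and the derivative along a constant
    vector [a] turns it by
    - [D radial = Dv meridian + sin v Du parallel],
    - [D meridian = - Dv radial + cos v Du parallel],
    - [D parallel = - Du (sin v radial + cos v meridian)].

    Here [D] is the derivative along [a]. The first line gives the bending at once, by orthonormality. Differentiating
    it again with the other two gives
    [DD sigma = - (Dv^2 + sin^2 v Du^2) sigma
    + (DDv - sin v cos v Du^2) meridian
    + (sin v DDu + 2 cos v Du Dv) parallel] ([derive2_polar]).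
    Summing over the standard basis and changing sign, the rough Laplacian is the
    bending times [sigma] plus two tangential terms, whose coefficients are
    [Delta v + sin v cos v |grad u|^2] and
    [sin v Delta u - 2 cos v grad u . grad v] ([rough_laplacian_polar]).
    So [sigma] is harmonic exactly when both coefficients vanish. The hypothesis
    that [sigma] avoids the two poles says that [sin v] is nonzero, and dividing
    the second equation by it yields the equation with the cotangent.

    All of this is local, and each point lies in the open domain of some branch of
    [u], so the argument runs branch by branch. *)

(** * Directional derivatives *)

(** Restricting to a line reduces directional derivatives to derivatives in one
    real variable, to which the one-variable chain rule applies. *)
Lemma is_derive_lineP (R : realType) (V W : normedModType R) (f : V -> W)
    (x a : V) (df : W) :
  is_derive x a f df <-> is_derive (0 : R) 1 (fun h : R => f (h *: a + x)) df.
Proof.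
have E : 'D_a f x = 'D_1 (fun h : R => f (h *: a + x)) 0.
  rewrite /derive; set g := (X in lim (X @ _)); set g' := (X in _ = lim (X @ _)).
  suff -> : g = g' by [].
  by apply/funext => h; rewrite /g /g' /= addr0 scale0r add0r /GRing.scale /= mulr1.
by split=> -[H HE]; split; rewrite ?E // -?E //; apply/(derivable1P f x a).
Qed.

Lemma is_derive_comp (R : realType) (V : normedModType R) (g : R -> R)
    (f : V -> R) (x a : V) (dg df : R) :
  is_derive (f x) 1 g dg -> is_derive x a f df ->
  is_derive x a (fun y => g (f y)) (dg * df).
Proof.
move=> Hg /is_derive_lineP Hf; apply/is_derive_lineP.
by apply: is_derive1_comp Hf; rewrite scale0r add0r.
Qed.

(** Reading vector-valued derivatives coordinate by coordinate is what transfers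
    the scalar product rule to the product of a function with a field. *)
Lemma is_derive_row (R : realType) (V : normedModType R) (n : nat)
    (F : V -> 'rV[R]_n) (x a : V) (dF : 'rV[R]_n) :
  is_derive x a F dF <->
  forall j, is_derive x a (fun y => F y 0 j) (dF 0 j).
Proof.
split=> [[HF HdF] j | H].
  split; first by move/derivable_mxP: HF.
  by rewrite -HdF derive_mx // mxE.
have HF : derivable F x a.
  by apply/derivable_mxP => i j; rewrite ord1; case: (H j).
split=> //; rewrite derive_mx //; apply/matrixP => i j.
by rewrite mxE ord1; case: (H j).
Qed.

Lemma is_derive_scale (R : realType) (V : normedModType R) (n : nat)
    (f : V -> R) (F : V -> 'rV[R]_n) (x a : V) (df : R) (dF : 'rV[R]_n) :
  is_derive x a f df -> is_derive x a F dF ->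
  is_derive x a (fun y => f y *: F y) (df *: F x + f x *: dF).
Proof.
move=> Hf /is_derive_row HF; apply/is_derive_row => j.
have := is_deriveM Hf (HF j).
have -> : f * (fun y => F y 0 j) = fun y => (f y *: F y) 0 j.
  by apply/funext => y; rewrite !mxE.
move=> H; apply: (is_derive_eq H); rewrite !mxE /GRing.scale /=; ring.
Qed.

Lemma is_derive_scale_cst (R : realType) (V : normedModType R) (n : nat)
    (f : V -> R) (c : 'rV[R]_n) (x a : V) (df : R) :
  is_derive x a f df -> is_derive x a (fun y => f y *: c) (df *: c).
Proof.
move=> Hf; have := is_derive_scale Hf (is_derive_cst c x a).
by rewrite /= scaler0 addr0.
Qed.

(** * The frame of spherical coordinates *)

Definition radial {R : realType} (xi : 'I_3 -> E3 R) (p t : R) : E3 R :=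
  (cos p * sin t) *: xi 0 + (sin p * sin t) *: xi 1 + cos t *: xi 2.

(** The unit tangent to the meridians of the sphere, that is the derivative of
    [radial] in the polar angle [t]. *)
Definition meridian {R : realType} (xi : 'I_3 -> E3 R) (p t : R) : E3 R :=
  (cos p * cos t) *: xi 0 + (sin p * cos t) *: xi 1 + (- sin t) *: xi 2.

(** The unit tangent to the parallels, oriented by the longitude [p]; the
    derivative of [radial] in [p] is [sin t] times this vector. *)
Definition parallel {R : realType} (xi : 'I_3 -> E3 R) (p : R) : E3 R :=
  (- sin p) *: xi 0 + cos p *: xi 1.

Lemma is_derive_comb3 (R : realType) (xi : 'I_3 -> E3 R) (f g h : E3 R -> R)
    (x a : E3 R) (df dg dh : R) :
  is_derive x a f df -> is_derive x a g dg -> is_derive x a h dh ->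
  is_derive x a (fun y => f y *: xi 0 + g y *: xi 1 + h y *: xi 2)
    (df *: xi 0 + dg *: xi 1 + dh *: xi 2).
Proof.
move=> Hf Hg Hh.
exact: is_deriveD (is_deriveD (is_derive_scale_cst _ Hf)
  (is_derive_scale_cst _ Hg)) (is_derive_scale_cst _ Hh).
Qed.

Lemma is_derive_sin_comp (R : realType) (V : normedModType R) (f : V -> R)
    (x a : V) (df : R) :
  is_derive x a f df -> is_derive x a (fun y => sin (f y)) (cos (f x) * df).
Proof. exact: is_derive_comp. Qed.

Lemma is_derive_cos_comp (R : realType) (V : normedModType R) (f : V -> R)
    (x a : V) (df : R) :
  is_derive x a f df -> is_derive x a (fun y => cos (f y)) (- sin (f x) * df).
Proof. exact: is_derive_comp. Qed.

Lemma is_derive_mul (R : realType) (V : normedModType R) (f g : V -> R)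
    (x a : V) (df dg : R) :
  is_derive x a f df -> is_derive x a g dg ->
  is_derive x a (fun y => f y * g y) (df * g x + f x * dg).
Proof.
move=> Hf Hg; apply: (is_derive_eq (is_deriveM Hf Hg)).
by rewrite /GRing.scale /= addrC mulrC.
Qed.

Section MovingFrame.
Context (R : realType) (xi : 'I_3 -> E3 R).

Lemma is_derive_radial (p t : E3 R -> R) (x a : E3 R) (dp dt : R) :
  is_derive x a p dp -> is_derive x a t dt ->
  is_derive x a (fun y => radial xi (p y) (t y))
    (dt *: meridian xi (p x) (t x) + (sin (t x) * dp) *: parallel xi (p x)).
Proof.
move=> Hp Ht; apply: is_derive_eq.
  apply: is_derive_comb3.
  - exact: is_derive_mul (is_derive_cos_comp Hp) (is_derive_sin_comp Ht).
  - exact: is_derive_mul (is_derive_sin_comp Hp) (is_derive_sin_comp Ht).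
  - exact: is_derive_cos_comp Ht.
by apply/rowP => j; rewrite !mxE; ring.
Qed.

Lemma is_derive_meridian (p t : E3 R -> R) (x a : E3 R) (dp dt : R) :
  is_derive x a p dp -> is_derive x a t dt ->
  is_derive x a (fun y => meridian xi (p y) (t y))
    (- dt *: radial xi (p x) (t x) + (cos (t x) * dp) *: parallel xi (p x)).
Proof.
move=> Hp Ht; apply: is_derive_eq.
  apply: is_derive_comb3.
  - exact: is_derive_mul (is_derive_cos_comp Hp) (is_derive_cos_comp Ht).
  - exact: is_derive_mul (is_derive_sin_comp Hp) (is_derive_cos_comp Ht).
  - exact: is_deriveN (is_derive_sin_comp Ht).
by apply/rowP => j; rewrite !mxE; ring.
Qed.

(** The vector [parallel] does not depend on the polar angle [t], which is
    introduced only to write its horizontal derivative in the frame: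
    [cos p xi_0 + sin p xi_1] is [sin t] times [radial] plus [cos t] times
    [meridian], whatever [t] is. *)
Lemma is_derive_parallel (p t : E3 R -> R) (x a : E3 R) (dp : R) :
  is_derive x a p dp ->
  is_derive x a (fun y => parallel xi (p y))
    (- dp *: (sin (t x) *: radial xi (p x) (t x)
              + cos (t x) *: meridian xi (p x) (t x))).
Proof.
move=> Hp; apply: is_derive_eq.
  apply: is_deriveD.
  - exact: is_derive_scale_cst (is_deriveN (is_derive_sin_comp Hp)).
  - exact: is_derive_scale_cst (is_derive_cos_comp Hp).
apply/rowP => j; rewrite !mxE.
have := cos2Dsin2 (t x).
set C := cos (t x); set S := sin (t x) => CS.
(* The factor C^2 + S^2 is isolated by hand since it is 1 only by a
   trigonometric identity. *)
have -> : - dp *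
  (S * (cos (p x) * S * xi 0 0 j + sin (p x) * S * xi 1 0 j + C * xi 2 0 j) +
   C * (cos (p x) * C * xi 0 0 j + sin (p x) * C * xi 1 0 j + - S * xi 2 0 j))
   = - dp * ((C ^+ 2 + S ^+ 2)
             * (cos (p x) * xi 0 0 j + sin (p x) * xi 1 0 j)) by ring.
by rewrite CS; ring.
Qed.

(** The field differentiated here is the first derivative of [radial] along [a]
    found in [is_derive_radial]. Each of the three frame vectors differentiates
    into the other two, so the coefficient of [radial] collects minus the squared
    length of the first derivative, as it must for a unit vector. *)
Lemma is_derive2_radial (p t dp dt : E3 R -> R) (x a : E3 R) (ddp ddt : R) :
  is_derive x a p (dp x) -> is_derive x a t (dt x) ->
  is_derive x a dp ddp -> is_derive x a dt ddt ->
  is_derive x a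
    (fun y => dt y *: meridian xi (p y) (t y)
              + (sin (t y) * dp y) *: parallel xi (p y))
    (- (dt x ^+ 2 + sin (t x) ^+ 2 * dp x ^+ 2) *: radial xi (p x) (t x)
     + (ddt - sin (t x) * cos (t x) * dp x ^+ 2) *: meridian xi (p x) (t x)
     + (sin (t x) * ddp + 2 * cos (t x) * (dp x * dt x))
         *: parallel xi (p x)).
Proof.
move=> Hp Ht Hdp Hdt; apply: is_derive_eq.
  apply: is_deriveD.
  - exact: is_derive_scale Hdt (is_derive_meridian Hp Ht).
  - exact: is_derive_scale (is_derive_mul (is_derive_sin_comp Ht) Hdp)
      (is_derive_parallel t Hp).
set E0 := radial _ _ _; set E1 := meridian _ _ _; set E2 := parallel _ _.
by apply/rowP => j; rewrite !mxE; ring.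
Qed.
End MovingFrame.

(** * Orthonormality of the frame *)

Lemma dotE (R : realType) (a b : E3 R) :
  dot a b = a 0 0 * b 0 0 + a 0 1 * b 0 1 + a 0 2 * b 0 2.
Proof.
rewrite /dot !big_ord_recr big_ord0 /= add0r.
by do ![congr (_ + _)]; congr (_ * _); congr (_ 0 _); apply/val_inj.
Qed.

Lemma dotC (R : realType) (a b : E3 R) : dot a b = dot b a.
Proof. by apply: eq_bigr => i _; rewrite mulrC. Qed.

Lemma dot_combl (R : realType) (xi : 'I_3 -> E3 R) (a b c : R) (y : E3 R) :
  dot (a *: xi 0 + b *: xi 1 + c *: xi 2) y
  = a * dot (xi 0) y + b * dot (xi 1) y + c * dot (xi 2) y.
Proof. by rewrite !dotE !mxE; ring. Qed.

Lemma dot_orthonormal (R : realType) (xi : 'I_3 -> E3 R) (a b c a' b' c' : R) :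
  (forall i j, dot (xi i) (xi j) = (i == j)%:R) ->
  dot (a *: xi 0 + b *: xi 1 + c *: xi 2) (a' *: xi 0 + b' *: xi 1 + c' *: xi 2)
  = a * a' + b * b' + c * c'.
Proof.
by move=> H; rewrite dot_combl 3!(dotC (xi _)) !dot_combl !H /=; ring.
Qed.

(** Where the orthonormality of the spherical frame enters: both the formula for
    the bending and the vanishing criterion [tangent_eq0] rest on it. *)
Lemma normsq_tangent (R : realType) (xi : 'I_3 -> E3 R) (p t a b : R) :
  (forall i j, dot (xi i) (xi j) = (i == j)%:R) ->
  normsq (a *: meridian xi p t + b *: parallel xi p) = a ^+ 2 + b ^+ 2.
Proof.
move=> H.
have -> : a *: meridian xi p t + b *: parallel xi p =
    (a * (cos p * cos t) - b * sin p) *: xi 0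
    + (a * (sin p * cos t) + b * cos p) *: xi 1 + (- a * sin t) *: xi 2.
  by apply/rowP => j; rewrite !mxE; ring.
rewrite /normsq dot_orthonormal //.
have p1 := cos2Dsin2 p; have t1 := cos2Dsin2 t.
have -> : a ^+ 2 + b ^+ 2 =
  a ^+ 2 * ((cos p ^+ 2 + sin p ^+ 2) * cos t ^+ 2 + sin t ^+ 2)
  + b ^+ 2 * (cos p ^+ 2 + sin p ^+ 2) by rewrite p1 mul1r t1 !mulr1.
by ring.
Qed.

Lemma tangent_eq0 (R : realType) (xi : 'I_3 -> E3 R) (p t a b : R) :
  (forall i j, dot (xi i) (xi j) = (i == j)%:R) ->
  a *: meridian xi p t + b *: parallel xi p = 0 <-> a = 0 /\ b = 0.
Proof.
move=> H; split=> [e|[-> ->]]; last by rewrite !scale0r addr0.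
have : a ^+ 2 + b ^+ 2 = 0.
  by rewrite -(normsq_tangent p t a b H) e /normsq dotE !mxE; ring.
move/eqP; rewrite paddr_eq0 ?sqr_ge0 // !sqrf_eq0 => /andP[/eqP-> /eqP->].
by [].
Qed.

(** * Connection and Laplacians in the standard frame *)

Lemma Ck_on_is_derive (R : realType) (W : normedModType R) (k : nat)
    (A : set (E3 R)) (f : E3 R -> W) (x a : E3 R) :
  Ck_on k.+1 A f -> A x -> is_derive x a f ('D_a f x).
Proof. by move=> [df _] Ax; split=> //; apply: diff_derivable; exact: df. Qed.

Lemma Ck_on_derive (R : realType) (W : normedModType R) (k : nat)
    (A : set (E3 R)) (f : E3 R -> W) (a : E3 R) :
  Ck_on k.+1 A f -> Ck_on k A ('D_a f).
Proof. by move=> [_ dfC]; exact: dfC. Qed.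

Lemma Ck_onS (R : realType) (W : normedModType R) (k : nat)
    (A B : set (E3 R)) (f : E3 R -> W) :
  A `<=` B -> Ck_on k B f -> Ck_on k A f.
Proof.
move=> AB; elim: k f => [|k IH] f /=; first by move=> fc x /AB; exact: fc.
by move=> [df dfC]; split=> [x /AB|a]; [exact: df | exact: IH].
Qed.

(** The standard frame is parallel, so the correction term of the second
    covariant derivative is a derivative along the zero vector. *)
Lemma nabla2_frame (R : realType) (i : 'I_3) (sigma : E3 R -> E3 R) (x : E3 R) :
  nabla2 (frame i) (frame i) sigma x =
  'D_(delta_mx 0 i) ('D_(delta_mx 0 i) sigma) x.
Proof.
rewrite /nabla2 /nabla {3}/frame derive_cst.
by have [_ ->] := is_derive0 sigma x; rewrite subr0.
Qed.

Lemma dot_delta (R : realType) (a : E3 R) (i : 'I_3) :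
  dot a (delta_mx 0 i) = a 0 i.
Proof.
rewrite /dot (bigD1 i) //= big1 => [|j ji].
  by rewrite !mxE !eqxx mulr1 addr0.
by rewrite !mxE (negbTE ji) andbF mulr0.
Qed.

Lemma laplacianE (R : realType) (A : set (E3 R)) (f : E3 R -> R) (x : E3 R) :
  Ck_on 2 A f -> A x ->
  laplacian f x = - \sum_(i < 3) 'D_(delta_mx 0 i) ('D_(delta_mx 0 i) f) x.
Proof.
move=> fC2 Ax; congr (- _); apply: eq_bigr => i _.
rewrite /nabla /frame /cst dot_delta.
have [_ ->] : is_derive x (delta_mx 0 i) (grad f)
    (\row_j 'D_(delta_mx 0 i) ('D_(delta_mx 0 j) f) x).
  apply/is_derive_row => j; rewrite mxE.
  have -> : (fun y => grad f y 0 j) = 'D_(delta_mx 0 j) f.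
    by apply/funext => y; rewrite mxE.
  exact: Ck_on_is_derive (Ck_on_derive _ fC2) Ax.
by rewrite mxE.
Qed.

Lemma dot_grad (R : realType) (f g : E3 R -> R) (x : E3 R) :
  dot (grad f x) (grad g x) =
  \sum_(i < 3) 'D_(delta_mx 0 i) f x * 'D_(delta_mx 0 i) g x.
Proof. by apply: eq_bigr => i _; rewrite !mxE. Qed.

(** * Fields in polar form *)

Section Polar.
Context (R : realType) (xi : 'I_3 -> E3 R) (U : set (E3 R)) (u v : E3 R -> R)
  (sigma : E3 R -> E3 R).
Context (orth : forall i j, dot (xi i) (xi j) = (i == j)%:R)
  (oU : open U) (su : Ck_on 2 U u) (sv : Ck_on 2 U v)
  (sigmaE : forall x, U x -> sigma x = radial xi (u x) (v x)).

Lemma derive_polar (x a : E3 R) : U x ->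
  'D_a sigma x = 'D_a v x *: meridian xi (u x) (v x)
                 + (sin (v x) * 'D_a u x) *: parallel xi (u x).
Proof.
move=> Ux.
rewrite (@near_eq_derive _ _ _ sigma (fun y => radial xi (u y) (v y))).
  by have [_] := is_derive_radial xi (Ck_on_is_derive a su Ux)
    (Ck_on_is_derive a sv Ux).
by near=> y; apply: sigmaE; near: y; exact: open_nbhs_nbhs.
Unshelve. all: by end_near. Qed.

(** Since [U] is open, [derive_polar] gives the first derivative on a whole
    neighbourhood of [x], and that formula can be differentiated once more. *)
Lemma derive2_polar (x a : E3 R) : U x ->
  'D_a ('D_a sigma) x =
    - ('D_a v x ^+ 2 + sin (v x) ^+ 2 * 'D_a u x ^+ 2) *: sigma x
    + ('D_a ('D_a v) x - sin (v x) * cos (v x) * 'D_a u x ^+ 2)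
        *: meridian xi (u x) (v x)
    + (sin (v x) * 'D_a ('D_a u) x + 2 * cos (v x) * ('D_a u x * 'D_a v x))
        *: parallel xi (u x).
Proof.
move=> Ux; rewrite (sigmaE Ux).
have [_ <-] := is_derive2_radial xi (Ck_on_is_derive a su Ux)
  (Ck_on_is_derive a sv Ux) (Ck_on_is_derive a (Ck_on_derive a su) Ux)
  (Ck_on_is_derive a (Ck_on_derive a sv) Ux).
apply: near_eq_derive.
by near=> y; apply: derive_polar; near: y; exact: open_nbhs_nbhs.
Unshelve. all: by end_near. Qed.

Lemma bending_polar (x : E3 R) : U x ->
  bending sigma x = normsq (grad v x) + sin (v x) ^+ 2 * normsq (grad u x).
Proof.
move=> Ux; rewrite /normsq !dot_grad mulr_sumr -big_split.
by apply: eq_bigr => i _; rewrite /nabla derive_polar // normsq_tangent //=; ring.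
Qed.

(** The radial part of the rough Laplacian of a unit field is always the bending;
    harmonicity is therefore the vanishing of the two tangential coefficients. *)
Lemma rough_laplacian_polar (x : E3 R) : U x ->
  rough_laplacian sigma x = bending sigma x *: sigma x
    + (laplacian v x + sin (v x) * cos (v x) * normsq (grad u x))
        *: meridian xi (u x) (v x)
    + (sin (v x) * laplacian u x - 2 * cos (v x) * dot (grad u x) (grad v x))
        *: parallel xi (u x).
Proof.
move=> Ux; rewrite bending_polar // !(laplacianE _ Ux) // /normsq !dot_grad.
rewrite /rough_laplacian.
under eq_bigr => i _ do rewrite nabla2_frame derive2_polar //.
rewrite !big_split /= -!scaler_suml !opprD -![in LHS]scaleNr.
congr (_ *: _ + _ *: _ + _ *: _).
- rewrite mulr_sumr -big_split -sumrN.
  by apply: eq_bigr => i _ /=; rewrite opprK !expr2.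
- rewrite mulr_sumr -!sumrN -big_split.
  by apply: eq_bigr => i _ /=; rewrite opprB addrC !expr2.
- rewrite mulrN !mulr_sumr -opprD -big_split.
  by congr (- _).
Qed.

Lemma harmonic_polar (x : E3 R) : U x -> sin (v x) != 0 ->
  rough_laplacian sigma x = bending sigma x *: sigma x <->
  laplacian u x = 2 * dot (grad u x) (grad v x) * cot (v x) /\
  laplacian v x = - normsq (grad u x) * cos (v x) * sin (v x).
Proof.
move=> Ux sv0; rewrite rough_laplacian_polar // -addrA.
set T := _ *: meridian _ _ _ + _.
have -> : bending sigma x *: sigma x + T = bending sigma x *: sigma x <-> T = 0.
  split=> [/eqP|->]; last by rewrite addr0.
  by rewrite -subr_eq0 addrAC subrr add0r => /eqP.
rewrite tangent_eq0 // /cot; split=> -[h1 h2]; split.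
- apply: (mulfI sv0); rewrite (subr0_eq h2); field; exact: sv0.
- by rewrite -[LHS]subr0 -h1; ring.
- by rewrite h2; ring.
- by rewrite h1; field; exact: sv0.
Qed.
End Polar.

Theorem proposition1 (R : realType) (M : set (E3 R)) (xi : 'I_3 -> E3 R)
    (sigma : E3 R -> E3 R) (I : Type) (U : I -> set (E3 R))
    (u : I -> E3 R -> R) (v : E3 R -> R)
    (M_domain : domain M)
    (xi_basis : right_handed_orthonormal xi)
    (sigma_field : smooth_unit_field M sigma)
    (sigma_neq : forall x, M x -> sigma x <> xi 2 /\ sigma x <> - xi 2)
    (sigma_polar : polar_form M xi sigma U u v) :
  (forall i x, U i x ->
     bending sigma x =
       normsq (grad v x) + sin (v x) ^+ 2 * normsq (grad (u i) x)) /\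
  (harmonic_field M sigma <->
   (forall i x, U i x ->
      laplacian (u i) x = 2 * dot (grad (u i) x) (grad v x) * cot (v x) /\
      laplacian v x = - normsq (grad (u i) x) * cos (v x) * sin (v x))).
Proof.
case: xi_basis => orth _; case: sigma_polar => sv MU oU su sigmaE.
have UM i : U i `<=` M by move=> x Ux; rewrite MU; exists i.
have svU i : Ck_on 2 (U i) v := Ck_onS (@UM i) (sv 2).
(* A zero of [sin v] would put [sigma] at one of the two poles. *)
have sin0 x : M x -> sin (v x) != 0.
  move=> Mx; apply/eqP => s0.
  have [i _ Ux] : (\bigcup_i U i) x by rewrite -MU.
  have := cos2Dsin2 (v x); rewrite s0 expr0n addr0 => /eqP.
  rewrite sqrf_eq1 => /orP[]/eqP c1; have [] := sigma_neq x Mx;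
    by rewrite (sigmaE i x Ux) s0 c1 !mulr0 !scale0r !add0r ?scale1r ?scaleN1r.
split=> [i x Ux|].
  exact: (bending_polar orth (oU i) (su i 2) (svU i) (sigmaE i) Ux).
have eqU i x : U i x -> _ := fun Ux =>
  harmonic_polar orth (oU i) (su i 2) (svU i) (sigmaE i) Ux (sin0 x (UM i x Ux)).
split=> [H i x Ux|H x Mx].
  by apply/(eqU i x Ux)/H/(UM i).
have [i _ Ux] : (\bigcup_i U i) x by rewrite -MU.
by apply/(eqU i x Ux)/H.
Qed.
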